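(* Let $R$ be a commutative ring with identity and let $M$ be a faithful finitely generated comultiplication $R$-module. Then $(0:_M \mathfrak{P}_I)=\mathfrak{S}_{(0:_M I)}$ for each ideal $I$ of $R$.
   Context: For an ideal $J$ of $R$, $(0:_M J)=\{m\in M: Jm=0\}$. $M$ is a comultiplication module if for every submodule $N$ of $M$ there is an ideal $I$ of $R$ with $N=(0:_M I)$. A non-zero submodule $N$ of $M$ is second if for each $a\in R$ the multiplication map $N\xrightarrow{a}N$ is either surjective or zero. A second submodule $N$ of $M$ is a maximal second submodule of $M$ if there is no second submodule $L$ of $M$ with $N\subsetneq L\subseteq M$. For a submodule $K$ of $M$, $\mathfrak{S}_K$ is the sum of all maximal second submodules of $M$ contained in $K$ (zero if there are none). For an ideal $I$ of $R$, $\mathfrak{P}_I$ is the intersection of all minimal prime ideals of $R$ that contain $I$ (the empty intersection being $R$). *)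

(* Defs.v *)
From HB Require Import structures.
From mathcomp Require Import all_boot all_algebra.
From mathcomp Require Import boolp classical_sets functions.

Set Implicit Arguments.
Unset Strict Implicit.
Unset Printing Implicit Defensive.

Import GRing.Theory.

Local Open Scope classical_set_scope.
Local Open Scope ring_scope.

Section Submodules.
Variables (R : comPzRingType) (M : lmodType R).
Implicit Types (N K L : set M) (J : set R).

Definition submodule N : Prop := GRing.submod_closed [in N].

(* (0 :_M J) *)
Definition annih_in J : set M := [set m | forall a, J a -> a *: m = 0].

Definition faithful : Prop :=
  forall a : R, (forall m : M, a *: m = 0) -> a = 0.

Definition finitely_generated : Prop :=
  exists (n : nat) (e : 'I_n -> M),
    forall m : M, exists c : 'I_n -> R, m = \sum_(i < n) c i *: e i.

Definition second N : Prop :=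
  [/\ submodule N, N <> [set 0] &
      forall a : R, set_surj N N ( *:%R a) \/ (forall x, N x -> a *: x = 0)].

Definition maximal_second N : Prop :=
  second N /\ forall L, second L -> ~ N `<` L.

(* The sum of a possibly infinite family of submodules: all finite sums of
   elements taken from members of the family; it is zero on the empty family. *)
Definition submodule_sum (F : set (set M)) : set M :=
  [set m | exists s : seq M,
     (forall x, x \in s -> exists2 N, F N & N x) /\ m = \sum_(x <- s) x].

Definition max_second_sum K : set M :=
  submodule_sum [set N | maximal_second N /\ N `<=` K].

End Submodules.

Arguments annih_in {R} M J.
Arguments faithful {R} M.
Arguments finitely_generated {R} M.

Section Ideals.
Variable R : comPzRingType.
Implicit Types I P Q : set R.

(* Not [idealr_closed], which requires the ideal to be proper and R nonzero. *)
Definition ideal I : Prop := submodule (I : set R^o).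

Definition prime_ideal P : Prop :=
  [/\ ideal P, ~ P 1 & forall a b : R, P (a * b) -> P a \/ P b].

Definition minimal_prime P : Prop :=
  prime_ideal P /\ forall Q, prime_ideal Q -> ~ Q `<` P.

(* The primes are minimal among all primes of R, not merely among those
   containing I; the intersection of the empty family is R. *)
Definition min_prime_meet I : set R :=
  \bigcap_(P in [set P | minimal_prime P /\ I `<=` P]) P.

End Ideals.

Definition comultiplication (R : comPzRingType) (M : lmodType R) : Prop :=
  forall N : set M, submodule N ->
    exists2 I : set R, ideal I & N = annih_in M I.

Arguments comultiplication {R} M.

(* Main.v *)
Require Import Defs.
From mathcomp Require Import all_boot all_algebra perm.
From mathcomp Require Import boolp classical_sets functions.

(** Everything rests on the fact that a prime [P] is recovered from its
    annihilator: a scalar that kills [(0 :_M P)] lies in [P]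
    ([prime_of_annih_in]).  Indeed, by comultiplication [P M = (0 :_M K)] for
    some [K].  If [b] lies in [K] then [P b M = 0], so [b M] lies in
    [(0 :_M P)] and is killed by any [a] that kills [(0 :_M P)].  Hence [K]
    kills [a M], that is, [a M] is contained in [(0 :_M K) = P M].  As [M] is
    finitely generated and faithful, the determinant trick puts [a] in [P].

    As every submodule [N] equals [(0 :_M ann N)], this yields a dictionary.
    If [P] is prime then [(0 :_M P)] is second: for [a] outside [P], the
    submodule [a (0 :_M P)] still has annihilator [P].  Conversely the
    annihilator of a second submodule is prime.  Since the correspondence
    reverses inclusions and every prime contains a minimal one, the maximal
    second submodules are exactly the [(0 :_M P)] with [P] a minimal prime, and
    [(0 :_M P)] lies in [(0 :_M I)] exactly when [I] lies in [P].

    It remains to compare a sum of annihilators with the annihilator of an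
    intersection, possibly over an infinite family.  The sum is of the form
    [(0 :_M K)]; such a [K] kills each summand [(0 :_M P)], so it lies in each
    [P], hence in their intersection. *)

Set Implicit Arguments.
Unset Strict Implicit.
Unset Printing Implicit Defensive.

Import GRing.Theory.

Local Open Scope classical_set_scope.
Local Open Scope ring_scope.

(** * Submodules and annihilators *)

Definition annihilator (R : comPzRingType) (M : lmodType R) (N : set M) :
  set R := [set a | forall x, N x -> a *: x = 0].

Section Submodules.
Variables (R : comPzRingType) (M : lmodType R).
Implicit Types (N L : set M) (J : set R).

Lemma submoduleP N :
  submodule N <-> N 0 /\ forall a x y, N x -> N y -> N (a *: x + y).
Proof.
split=> -[N0 NZD].
  split=> [|a x y Nx Ny]; first by rewrite -in_setE.
  by rewrite -in_setE; apply: NZD; rewrite inE.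
by split=> [|a x y]; rewrite !inE // => Nx Ny; apply: NZD.
Qed.

Lemma submodule0 N : submodule N -> N 0.
Proof. by case/submoduleP. Qed.

Lemma submoduleD N x y : submodule N -> N x -> N y -> N (x + y).
Proof. by case/submoduleP=> _ NZD Nx Ny; rewrite -[x]scale1r; apply: NZD. Qed.

Lemma submoduleZ N a x : submodule N -> N x -> N (a *: x).
Proof. by case/submoduleP=> N0 NZD Nx; rewrite -[_ *: _]addr0; apply: NZD. Qed.

Lemma submoduleB N x y : submodule N -> N x -> N y -> N (x - y).
Proof.
by move=> sN Nx Ny; rewrite -scaleN1r; apply: submoduleD=> //; apply: submoduleZ.
Qed.

Lemma submodule_big N (I : Type) (s : seq I) (Q : pred I) (F : I -> M) :
  submodule N -> (forall i, Q i -> N (F i)) -> N (\sum_(i <- s | Q i) F i).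
Proof.
move=> sN NF; apply: (big_ind N) => //; first exact: submodule0.
by move=> x y; apply: submoduleD.
Qed.

Lemma submodule_annih_in J : submodule (annih_in M J).
Proof.
apply/submoduleP; split=> [a _|b x y Jx Jy a Ja]; first exact: scaler0.
by rewrite scalerDr scalerA mulrC -scalerA Jx // Jy // scaler0 addr0.
Qed.

Lemma submodule_scale N a : submodule N -> submodule ( *:%R a @` N).
Proof.
move=> sN; apply/submoduleP; split.
  by exists 0; [exact: submodule0 | rewrite scaler0].
move=> b _ _ [x Nx <-] [y Ny <-]; exists (b *: x + y).
  by apply: submoduleD => //; apply: submoduleZ.
by rewrite scalerDr !scalerA mulrC.
Qed.

Lemma submodule_submodule_sum (F : set (set M)) :
  (forall N, F N -> submodule N) -> submodule (submodule_sum F).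
Proof.
move=> sF; apply/submoduleP; split; first by exists [::]; rewrite big_nil.
move=> a _ _ [s [Fs ->]] [t [Ft ->]].
exists ([seq a *: x | x <- s] ++ t); split.
  move=> x; rewrite mem_cat => /orP[/mapP[y /Fs[N FN Ny] ->]|/Ft //].
  by exists N => //; apply: submoduleZ => //; apply: sF.
by rewrite big_cat big_map scaler_sumr.
Qed.

Lemma annih_inS J J' : J `<=` J' -> annih_in M J' `<=` annih_in M J.
Proof. by move=> JJ' x J'x a /JJ'; apply: J'x. Qed.

Lemma comultiplicationE N :
  comultiplication M -> submodule N -> N = annih_in M (annihilator N).
Proof.
move=> comM /comM[J _ NJ]; apply/seteqP; split=> [x Nx a|x Nx]; first exact.
rewrite NJ => a Ja; apply: Nx => y.
by rewrite NJ; apply.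
Qed.

End Submodules.

(** * Prime ideals *)

Section Primes.
Variable R : comPzRingType.
Implicit Types P Q : set R.

Lemma idealM P a b : ideal P -> P b -> P (a * b).
Proof. exact: (@submoduleZ R R^o). Qed.

Lemma ideal_annihilator (M : lmodType R) (N : set M) : ideal (annihilator N).
Proof.
apply/submoduleP; split=> [x _|b c d Nc Nd x Nx]; first exact: scale0r.
by rewrite scalerDl Nd // addr0 -scalerA Nc // scaler0.
Qed.

Lemma prime_annihilator (M : lmodType R) (N : set M) :
  second N -> prime_ideal (annihilator N).
Proof.
move=> [sN N0 secN]; split; first exact: ideal_annihilator.
  move=> N1; apply: N0; apply/seteqP; split=> [x Nx|_ ->].
    by rewrite /= -[x]scale1r; apply: N1.
  exact: submodule0 sN.
move=> a b abN; have [surb|] := secN b; last by right.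
by left=> _ /surb[y Ny <-]; rewrite scalerA; apply: abN.
Qed.

(** For a nonempty chain of primes: if [a] and [b] are outside the intersection,
    one member of the chain avoids both of them. *)
Lemma prime_bigcap_chain (F : set (set R)) :
  F !=set0 -> (forall P, F P -> prime_ideal P) -> total_on F subset ->
  prime_ideal (\bigcap_(P in F) P).
Proof.
move=> [P0 FP0] prF totF; split.
- apply/submoduleP; split=> [P /prF[idP _ _]|a x y Fx Fy P FP].
    exact: (@submodule0 R R^o).
  have [idP _ _] := prF _ FP.
  apply: (@submoduleD R R^o) => //; first apply: (@submoduleZ R R^o) => //.
    exact: Fx.
  exact: Fy.
- by move=> /(_ _ FP0); have [_ ] := prF _ FP0.
- move=> a b Fab; apply: contrapT => /not_orP[].
  move=> /existsNP[P /not_implyP[FP Pa]] /existsNP[Q /not_implyP[FQ Qb]].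
  have [PQ|QP] := totF _ _ FP FQ.
    have [_ _ /(_ a b (Fab _ FP))[]//] := prF _ FP.
    by move=> /PQ.
  have [_ _ /(_ a b (Fab _ FQ))[/QP//|//]] := prF _ FQ.
Qed.

(** Zorn's lemma is applied to the sets [A] such that [Q `\` A] is prime, so
    that unions of chains become intersections of primes.  The empty chain is
    covered because [Q] itself is prime. *)
Lemma exists_minimal_prime Q :
  prime_ideal Q -> exists2 P, minimal_prime P & P `<=` Q.
Proof.
move=> prQ.
have [F prF totF|A [prA maxA]] :=
    @Zorn_bigcup R [set A | prime_ideal (Q `\` A)].
  rewrite /mkset; have -> : Q `\` \bigcup_(X in F) X =
      \bigcap_(P in [set Q `\` A | A in set0 |` F]) P.
    apply/seteqP; split=> [x [Qx Fx] _ [A FA <-]|x Fx].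
      split=> // Ax; case: FA => [A0|FA]; first by rewrite A0 in Ax.
      by apply: Fx; exists A.
    have [|Qx _] := Fx (Q `\` set0); first by exists set0 => //; left.
    split=> // -[A FA Ax]; have [|//] := Fx (Q `\` A).
    by exists A => //; right.
  apply: prime_bigcap_chain.
  - by exists (Q `\` set0); exists set0 => //; left.
  - by move=> _ [A [->|/prF prA] <-] //; rewrite setD0.
  - move=> _ _ [A FA <-] [B FB <-].
    have [AB|BA] : A `<=` B \/ B `<=` A.
      case: FA FB => [->|FA] [->|FB]; by [left|right|exact: totF].
    + by right; exact: setDS.
    + by left; exact: setDS.
exists (Q `\` A); last exact: subDsetl.
split=> // P prP [PQA /nonsubset[x [[Qx Ax] Px]]]; apply: (maxA (~` P)).
  split; first by move=> y Ay /PQA[].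
  by move=> /(_ x Px).
rewrite /= setDE setCK setIidr // => y /PQA; exact: proj1.
Qed.

(** Modulo [P] the matrix is diagonal with nonzero entries in a domain. *)
Lemma det_notin_prime P n (A : 'M[R]_n) :
  prime_ideal P -> (forall i j, i != j -> P (A i j)) ->
  (forall i, ~ P (A i i)) -> ~ P (\det A).
Proof.
move=> [idP P1 prP] Aoff Adiag Pdet.
have : ~ P (\prod_i A i i).
  apply: (big_ind (fun x => ~ P x)) => // x y Px Py /prP[]//.
apply; have detE : \det A = \prod_i A i i +
    \sum_(s : 'S_n | s != 1%g) (-1) ^+ s * \prod_i A i (s i).
  rewrite /determinant (bigD1 (1%g : 'S_n)) //= odd_perm1 expr0 mul1r.
  by congr (_ + _); apply: eq_bigr => i _; rewrite perm1.
rewrite -[X in P X](addrK (\sum_(s : 'S_n | s != 1%g)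
  (-1) ^+ s * \prod_i A i (s i))) -detE.
apply: (@submoduleB R R^o) => //.
apply: (@submodule_big R R^o) => // s s1; apply: idealM => //.
have [i si] : exists i, s i != i.
  apply/existsP; apply: contraNT s1 => /existsPn s1.
  by apply/eqP/permP => i; rewrite perm1; apply/eqP; rewrite -[_ == _]negbK.
rewrite (bigD1 i) //= mulrC; apply: idealM => //.
by apply: Aoff; rewrite eq_sym.
Qed.

(** Cramer's rule with unknowns in a module. *)
Lemma det_annihilates (M : lmodType R) n (A : 'M[R]_n) (e : 'I_n -> M) :
  (forall i, \sum_j A i j *: e j = 0) -> forall k, \det A *: e k = 0.
Proof.
move=> Ae k.
have -> : \det A *: e k = \sum_j ((\det A)%:M : 'M_n) k j *: e j.
  rewrite (bigD1 k) //= mxE eqxx mulr1n big1 ?addr0 // => j jk.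
  by rewrite mxE eq_sym (negbTE jk) mulr0n scale0r.
rewrite -mul_adj_mx.
under eq_bigr => j _ do rewrite mxE scaler_suml.
rewrite exchange_big /= big1 // => i _.
under eq_bigr => j _ do rewrite -scalerA.
by rewrite -scaler_sumr Ae scaler0.
Qed.

(** The determinant trick for a prime: the hypothesis on [a] says that
    [a M] is contained in [P M].  The resulting matrix has determinant
    congruent to a power of [a] modulo [P], but this determinant kills [M] and
    so is zero. *)
Lemma prime_of_scale_gens (M : lmodType R) P n (e : 'I_n -> M) a :
  faithful M ->
  (forall m : M, exists c : 'I_n -> R, m = \sum_(i < n) c i *: e i) ->
  prime_ideal P ->
  (forall i, exists c : 'I_n -> R,
     (forall j, P (c j)) /\ a *: e i = \sum_j c j *: e j) ->
  P a.
Proof.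
move=> faiM gen prP /choice[c /all_and2[Pc ae]]; have [idP _ _] := prP.
apply: contrapT => Pa.
pose A := \matrix_(i, j) (a *+ (i == j) - c i j).
have : ~ P (\det A).
  apply: det_notin_prime => // [i j ij|i]; rewrite mxE.
    rewrite (negbTE ij) mulr0n; apply: (@submoduleB R R^o) => //.
    exact: (@submodule0 R R^o).
  rewrite eqxx mulr1n => Pd; apply: Pa; rewrite -[a](subrK (c i i)).
  exact: (@submoduleD R R^o).
apply; suff -> : \det A = 0 by exact: (@submodule0 R R^o).
apply: faiM => m; have [d ->] := gen m.
rewrite scaler_sumr big1 // => i _.
rewrite scalerA mulrC -scalerA (det_annihilates (A := A)) ?scaler0 // => k.
under eq_bigr => j _ do rewrite mxE scalerBl.
rewrite sumrB -ae (bigD1 k) //= eqxx mulr1n big1 ?addr0 ?subrr // => j jk.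
by rewrite eq_sym (negbTE jk) mulr0n scale0r.
Qed.

End Primes.

(** * Maximal second submodules of a comultiplication module *)

Section Comultiplication.
Variables (R : comPzRingType) (M : lmodType R).
Hypotheses (faithful_M : faithful M) (fg_M : finitely_generated M)
  (comult_M : comultiplication M).
Implicit Types (P I : set R) (N : set M).

(** By comultiplication, [a M] is contained in [P M] as soon as every scalar
    killing [P M] also kills [a M]; this reduces to the determinant trick. *)
Lemma prime_of_annih_in P a :
  prime_ideal P -> annihilator (annih_in M P) a -> P a.
Proof.
move=> prP Pa; have [idP _ _] := prP; have [n [e gen]] := fg_M.
pose PM := [set m | exists c : 'I_n -> R,
  (forall j, P (c j)) /\ m = \sum_j c j *: e j].
have sPM : submodule PM.
  apply/submoduleP; split.
    exists (fun=> 0); split=> [_|]; first exact: (@submodule0 R R^o).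
    by rewrite big1 // => j _; rewrite scale0r.
  move=> b _ _ [c [Pc ->]] [d [Pd ->]].
  exists (fun j => b * c j + d j); split=> [j|].
    by apply: (@submoduleD R R^o) => //; exact: idealM.
  rewrite scaler_sumr -big_split; apply: eq_bigr => j _ /=.
  by rewrite scalerDl scalerA.
have PMscale p m : P p -> PM (p *: m).
  move=> Pp; have [c ->] := gen m; exists (fun j => c j * p); split=> [j|].
    exact: idealM.
  by rewrite scaler_sumr; apply: eq_bigr => j _; rewrite scalerA mulrC.
apply: (prime_of_scale_gens faithful_M gen prP) => i.
suff : PM (a *: e i) by [].
rewrite (comultiplicationE comult_M sPM) => b bPM.
rewrite scalerA mulrC -scalerA; apply: Pa => p Pp.
by rewrite scalerA mulrC -scalerA; apply: bPM; exact: PMscale.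
Qed.

Lemma annihilator_annih_in P :
  prime_ideal P -> annihilator (annih_in M P) = P.
Proof.
move=> prP; apply/seteqP; split=> a; first exact: prime_of_annih_in.
by move=> Pa x; apply.
Qed.

Lemma second_annih_in P : prime_ideal P -> second (annih_in M P).
Proof.
move=> prP; have [_ P1 mulP] := prP.
have annP := annihilator_annih_in prP.
split; first exact: submodule_annih_in.
  move=> P0; apply: P1; rewrite -annP P0 => _ ->; exact: scaler0.
move=> a; have [Pa|Pa] := pselect (P a); first by right=> x; apply.
left=> x Px; rewrite (comultiplicationE comult_M (submodule_scale a _)).
(* The annihilator of [a (0 :_M P)] is [P], because [a] is outside [P]. *)
  move=> b abN; apply: Px; have [] // := mulP b a.
  rewrite -annP => y Py; rewrite -scalerA; apply: abN; by exists y.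
exact: submodule_annih_in.
Qed.

Lemma maximal_second_annih_in P :
  minimal_prime P -> maximal_second (annih_in M P).
Proof.
move=> [prP minP]; split; first exact: second_annih_in.
move=> L secL [PL LP]; have [sL _ _] := secL.
apply: (minP _ (prime_annihilator secL)); split.
  by move=> a aL; apply: prime_of_annih_in => // x /PL; exact: aL.
by move=> /(@annih_inS _ M); rewrite -(comultiplicationE comult_M sL).
Qed.

(** A minimal prime inside the annihilator of [N] gives a second submodule
    containing [N], which maximality forces to be [N]. *)
Lemma minimal_prime_annihilator N :
  maximal_second N -> minimal_prime (annihilator N).
Proof.
move=> [secN maxN]; have [sN _ _] := secN.
have [P minP PN] := exists_minimal_prime (prime_annihilator secN).
have [prP _] := minP.
suff -> : N = annih_in M P by rewrite annihilator_annih_in.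
have NP : N `<=` annih_in M P.
  by rewrite {1}(comultiplicationE comult_M sN); exact: annih_inS.
apply/seteqP; split=> //; apply: contrapT => PsubN.
exact: (maxN _ (second_annih_in prP)).
Qed.

Lemma annih_in_min_prime_meet I :
  annih_in M (min_prime_meet I) = max_second_sum (annih_in M I).
Proof.
apply/seteqP; split.
  have sS : submodule (max_second_sum (annih_in M I)).
    by apply: submodule_submodule_sum => N [[[]]].
  rewrite (comultiplicationE comult_M sS); apply: annih_inS => a aS P [minP IP].
  apply: prime_of_annih_in; first by case: minP.
  move=> x Px; apply: aS; exists [:: x]; split; last by rewrite big_seq1.
  move=> y; rewrite inE => /eqP ->; exists (annih_in M P) => //; split.
    exact: maximal_second_annih_in.
  exact: annih_inS.
move=> _ [s [sN ->]]; rewrite big_seq.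
apply: submodule_big; first exact: submodule_annih_in.
move=> x /sN[N [maxN NI] Nx] a aI.
have minN := minimal_prime_annihilator maxN.
by apply: (aI (annihilator N)) => //; split=> // b Ib y /NI; apply.
Qed.

End Comultiplication.

Theorem theorem2p3 (R : comPzRingType) (M : lmodType R)
    (faithful_M : faithful M) (fg_M : finitely_generated M)
    (comult_M : comultiplication M) (I : set R) (ideal_I : ideal I) :
  annih_in M (min_prime_meet I) = max_second_sum (annih_in M I).
Proof. exact: annih_in_min_prime_meet. Qed.
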